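(* Let $n\ge 2$. For any choice of $k$-cycles $u_k$ on $\{1,\dots,k\}$, $k=2,\dots,n$, the elements $g_k=u_2u_3\cdots u_k$ satisfy $g_k\in G_k\setminus G_{k-1}$ for all $2\le k\le n$. Consequently the number of towers $(g_2,\dots,g_n)$ is the superfactorial $1!\,2!\cdots(n-1)!$.
   Context: Permutations in $S_n$ are multiplied as functions: $(\pi g)(i)=\pi(g(i))$. For $1\le k\le n$, $G_k=\mathrm{Sym}\{1,\dots,k\}$ is the subgroup of $S_n$ of permutations fixing each of $k+1,\dots,n$. A $k$-cycle on $\{1,\dots,k\}$ is an element of $G_k$ that is a single cycle of length $k$. A tower is a sequence $(g_2,\dots,g_n)$ with $g_k\in G_k\setminus G_{k-1}$ such that, setting $g_1:=\mathbf 1$, each $u_k:=g_{k-1}^{-1}g_k$ is a $k$-cycle on $\{1,\dots,k\}$ $(2\le k\le n)$. *)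

(* Defs.v *)
From mathcomp Require Import all_boot all_fingroup.

Set Implicit Arguments.
Unset Strict Implicit.
Unset Printing Implicit Defensive.

Import GroupScope.

(* The point i of {1, ..., n} is encoded as the ordinal i - 1 : 'I_n. *)

(* (perm_comp p g) i = p (g i): permutations multiplied as functions.
   The group law of 'S_n composes in the opposite order. *)
Definition perm_comp (n : nat) (p g : 'S_n) : 'S_n := g * p.

Lemma perm_compE (n : nat) (p g : 'S_n) (i : 'I_n) :
  perm_comp p g i = p (g i).
Proof. exact: permM. Qed.

(* The set {1, ..., k}. *)
Definition initial (n k : nat) : {set 'I_n} := [set i : 'I_n | (i < k)%N].

(* Sym A consists of the permutations fixing every point outside A. *)
Definition symG (n k : nat) : {set 'S_n} := Sym (initial n k).

Definition is_kcycle (n k : nat) (u : 'S_n) : bool :=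
  (u \in symG n k) && (initial n k \in porbits u).

(* The k-th element, 1 <= k <= n, of (g_1 = 1, g_2, ..., g_n), where
   t = (g_2, ..., g_n). *)
Definition tower_elt (n : nat) (t : n.-1.-tuple 'S_n) (k : nat) : 'S_n :=
  nth 1 (1 :: t) k.-1.

Definition is_tower (n : nat) (t : n.-1.-tuple 'S_n) : bool :=
  [forall (k : 'I_n.+1 | (2 <= k)%N),
     (tower_elt t k \in symG n k :\: symG n k.-1)
     && is_kcycle k (perm_comp (tower_elt t k.-1)^-1 (tower_elt t k))].

(* Main.v *)
Require Import Defs.
From HB Require Import structures.
From mathcomp Require Import all_boot all_fingroup.

Set Implicit Arguments.
Unset Strict Implicit.
Unset Printing Implicit Defensive.

Import GroupScope.

(** The two halves rest on one remark: [g_k] and [g_(k-1)] differ by the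
factor [u_k], which lies in [G_k] but not in [G_(k-1)], because a cycle of
length at least 2 on [{1, ..., k}] moves the point [k].  As [g_(k-1)] belongs
to the group [G_(k-1)], the product [g_k = g_(k-1) u_k] cannot belong to it
([prod_kcycles_symGD]).

Hence the condition on the sets [G_k \ G_(k-1)] in the definition of a tower
follows from the condition on the quotients ([is_towerE]).  A sequence
[(g_2, ..., g_n)] and the sequence [(u_2, ..., u_n)] of its successive
quotients determine each other, so towers are in bijection with arbitrary
choices of a [k]-cycle for each [k] from 2 to [n] ([card_towers]).

It remains to count the permutations that are a single cycle on a nonempty set
[A]: after fixing a starting point [a] in [A], such a permutation is the same
thing as an ordering [u a, u (u a), ...] of [A] minus [a], so there are
[(#|A| - 1)!] of them ([card_single_cycles]). *)

(** * Cycles and orderings *)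

Section SingleCycles.

Variable T : finType.

(** Removing duplicates makes [next] injective for every sequence, so that this
is a total function; it is only meant for duplicate-free sequences. *)
Definition seq_cycle (s : seq T) : {perm T} :=
  perm (can_inj (prev_next (undup_uniq s))).

Lemma seq_cycleE s x : uniq s -> seq_cycle s x = next s x.
Proof. by move=> Us; rewrite permE undup_id. Qed.

Lemma fcycle_seq_cycle s : uniq s -> fcycle (seq_cycle s) s.
Proof.
move=> Us; rewrite (eq_cycle (e' := frel (next s))) ?cycle_next // => x y /=.
by rewrite seq_cycleE.
Qed.

(** The ordering can be read back from the permutation once the starting point
is known: the tail of the sequence lists the successive images of [a]. *)
Lemma seq_cycle_traject a t :
  uniq (a :: t) -> let u := seq_cycle (a :: t) in t = traject u (u a) (size t).
Proof.
move=> Ut u; have: fcycle u (a :: t) by exact: fcycle_seq_cycle.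
by rewrite /= rcons_path => /andP[/fpathE].
Qed.

Lemma porbit_seq_cycle a t :
  uniq (a :: t) -> porbit (seq_cycle (a :: t)) a =i a :: t.
Proof.
move=> Ut; set u := seq_cycle _ => x; apply/porbitP/idP => [[i ->] | tx].
  rewrite permX; elim: i => [|i IHi] /=; first exact: mem_head.
  by rewrite seq_cycleE // mem_next.
have: x \in traject u a (size t).+1 by rewrite /= -seq_cycle_traject.
by case/trajectP => i _ ->; exists i; rewrite permX.
Qed.

Lemma perm_on_seq_cycle s : uniq s -> perm_on [set x in s] (seq_cycle s).
Proof.
move=> Us; apply/subsetP => x; rewrite !inE seq_cycleE //.
by rewrite next_nth; case: (x \in s) => //; rewrite eqxx.
Qed.

(** If [u] is a single cycle on [A] and [a] is in [A], then the sequence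
[a, u a, u (u a), ...] of length [#|A|] closes up, and [u] is its cycle. *)
Lemma seq_cycle_single (A : {set T}) a (u : {perm T}) (s := traject u a #|A|) :
  perm_on A u -> porbit u a = A -> [/\ uniq s, s =i A & seq_cycle s = u].
Proof.
move=> Au defA; have Us : uniq s by rewrite /s -defA uniq_traject_porbit.
have sA : s =i A by move=> x; rewrite /s -[in RHS]defA porbit_traject defA.
split=> //; apply/permP => x; rewrite seq_cycleE //.
have [Ax | A'x] := boolP (x \in A); last first.
  by rewrite next_nth sA (negPf A'x) (out_perm Au).
rewrite (@nextE _ u) ?sA // /s; have := iter_porbit u a.
rewrite defA; case: #|A| => [//|m] um /=.
by rewrite -[X in rcons _ X]um iterSr -trajectSr fpath_traject.
Qed.

(** With a starting point [a] in [A] fixed, [t |-> seq_cycle (a :: t)] is a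
bijection from the orderings [t] of [A] minus [a] to the single cycles on [A]. *)
Lemma card_single_cycles (A : {set T}) :
  A != set0 -> #|[set u in Sym A | A \in porbits u]| = (#|A|.-1)`!.
Proof.
case/set0Pn => a Aa; pose E := [set t : (#|A|.-1).-tuple T |
  all [in A :\ a] t & uniq t].
have A_gt0 : 0 < #|A| by apply/card_gt0P; exists a.
have cAa : #|A :\ a| = #|A|.-1 by rewrite (cardsD1 a A) Aa.
have EP (t : (#|A|.-1).-tuple T) : t \in E -> uniq (a :: t) /\ a :: t =i A.
  rewrite inE => /andP[/allP At Ut].
  have a't : a \notin t by apply/negP => /At; rewrite !inE eqxx.
  have Uat : uniq (a :: t) by rewrite /= a't.
  split=> //; have sat : {subset a :: t <= A}.
    by move=> x /predU1P[-> // | /At]; rewrite !inE => /andP[].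
  (* A duplicate-free sequence of [#|A|] elements of [A] exhausts [A]. *)
  have [x /sat | | _ eqA x] := uniq_min_size Uat (s2 := enum A).
  - by rewrite mem_enum.
  - by rewrite -cardE /= size_tuple prednK.
  by rewrite eqA mem_enum.
rewrite -ffactnn -{1}cAa -card_uniq_tuples -/E.
pose F (t : (#|A|.-1).-tuple T) := seq_cycle (a :: t).
rewrite -(card_in_imset (f := F) (D := E)); last first.
  move=> t1 t2 /EP[U1 _] /EP[U2 _] eqF; apply: val_inj => /=.
  rewrite (seq_cycle_traject U1) (seq_cycle_traject U2) !size_tuple.
  by rewrite -/(F t1) -/(F t2) eqF.
apply: eq_card => u; rewrite !inE; apply/andP/imsetP => [[Au] | [t Et ->]].
  case/imsetP => y _ defy.
  have defA : porbit u a = A by apply/eqP; rewrite defy eq_porbit_mem -defy.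
  have [Us sA us] := seq_cycle_single Au defA.
  have def_s : traject u a #|A| = a :: traject u (u a) #|A|.-1.
    by rewrite -[in LHS](prednK A_gt0).
  have sz_t : size (traject u (u a) #|A|.-1) == #|A|.-1 by rewrite size_traject.
  exists (Tuple sz_t); last by rewrite /F /= -def_s us.
  rewrite def_s /= in Us sA; case/andP: Us => a't Ut.
  rewrite inE /= Ut andbT; apply/allP => x tx; rewrite !inE -sA inE tx orbT.
  by rewrite andbT; apply: contraTneq tx => ->.
have [Uat atA] := EP t Et.
have defA : [set x in a :: t] = A by apply/setP => x; rewrite inE atA.
split; first by rewrite -[X in perm_on X _]defA perm_on_seq_cycle.
apply/imsetP; exists a => //; apply/setP => x.
by rewrite porbit_seq_cycle // atA.
Qed.

End SingleCycles.

(** * Products of cycles *)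

Section Towers.

Variable n : nat.
Implicit Types (k : nat) (u g : 'S_n).

Canonical symG_group k := [group of symG n k].

Lemma symGS j k : j <= k -> symG n j \subset symG n k.
Proof.
move=> le_jk; apply/subsetP => u; rewrite !inE => /subset_trans; apply.
by apply/subsetP => i; rewrite !inE => /leq_trans; apply.
Qed.

Lemma card_initial k : k <= n -> #|initial n k| = k.
Proof.
by move=> le_kn; rewrite -sum1dep_card (big_ord_narrow le_kn) sum1_card card_ord.
Qed.

Lemma card_kcycles k :
  0 < k <= n -> #|[set u : 'S_n | is_kcycle k u]| = (k.-1)`!.
Proof.
case/andP=> k_gt0 le_kn; rewrite -{2}(card_initial le_kn).
by rewrite -card_single_cycles // -card_gt0 card_initial.
Qed.

(** A permutation in [G_(k-1)] fixes the point [k], so that [{k}] is one of its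
orbits; it cannot also have the larger orbit [{1, ..., k}]. *)
Lemma kcycle_notin k u : 2 <= k <= n -> is_kcycle k u -> u \notin symG n k.-1.
Proof.
case/andP=> k_gt1 le_kn /andP[_ /imsetP[x _ def_x]].
have lt_kn : k.-1 < n by rewrite prednK // ltnW.
pose i := Ordinal lt_kn; apply: contraL k_gt1; rewrite inE => u_on.
have ui : u i = i by rewrite (out_perm u_on) // inE ltnn.
have /eqP orb_i : porbit u i == porbit u x.
  by rewrite eq_porbit_mem -def_x inE /= prednK // -(card_initial le_kn) def_x
     lt0n card_porbit_neq0.
rewrite -leqNgt -(card_initial le_kn) def_x -orb_i -(cards1 i) subset_leq_card //.
apply/subsetP => _ /porbitP[m ->]; rewrite inE permX; apply/eqP.
by elim: m => //= m ->.
Qed.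

Lemma perm_compA : associative (@perm_comp n).
Proof. by move=> p q r; rewrite /perm_comp mulgA. Qed.

Lemma perm_comp1g : left_id 1 (@perm_comp n).
Proof. by move=> p; rewrite /perm_comp mulg1. Qed.

Lemma perm_compg1 : right_id 1 (@perm_comp n).
Proof. by move=> p; rewrite /perm_comp mul1g. Qed.

HB.instance Definition _ :=
  Monoid.isLaw.Build 'S_n 1 (@perm_comp n) perm_compA perm_comp1g perm_compg1.

Section Products.

Variable u : nat -> 'S_n.
Hypothesis u_cycle : forall k, 2 <= k <= n -> is_kcycle k (u k).

Lemma prod_kcycles_symG k :
  k <= n -> \big[@perm_comp n/1]_(2 <= i < k.+1) u i \in symG n k.
Proof.
move=> le_kn; rewrite big_seq.
apply: (big_ind (fun g => g \in symG n k)) => [|p q pG qG|i]; first exact: group1.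
  exact: groupM.
rewrite mem_index_iota ltnS => /andP[i_gt1 le_ik].
apply: (subsetP (symGS le_ik)).
by have /andP[] : is_kcycle i (u i) by rewrite u_cycle // i_gt1 (leq_trans le_ik).
Qed.

Lemma prod_kcycles_symGD k :
  2 <= k <= n ->
  \big[@perm_comp n/1]_(2 <= i < k.+1) u i \in symG n k :\: symG n k.-1.
Proof.
move=> k_bnd; have /andP[k_gt1 le_kn] := k_bnd.
have k_gt0 : 0 < k by exact: ltnW.
rewrite in_setD prod_kcycles_symG // andbT big_nat_recr //=.
have := @prod_kcycles_symG k.-1; rewrite prednK // => symG_prev.
rewrite /perm_comp groupMr ?symG_prev ?(leq_trans (leq_pred k)) //.
exact: kcycle_notin (u_cycle k_bnd).
Qed.

End Products.

(** * Towers and their successive quotients *)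

Definition tower_quotient (t : n.-1.-tuple 'S_n) k : 'S_n :=
  perm_comp (tower_elt t k.-1)^-1 (tower_elt t k).

Lemma prod_tower_quotient t k :
  0 < k ->
  \big[@perm_comp n/1]_(2 <= i < k.+1) tower_quotient t i = tower_elt t k.
Proof.
elim: k => // -[|k] IHk _; first by rewrite big_geq.
by rewrite big_nat_recr //= IHk // /tower_quotient /perm_comp mulgKV.
Qed.

(** A tower is the sequence of partial products of its quotients, so the
condition [g_k \in G_k \ G_(k-1)] is a consequence of the quotients being
cycles. *)
Lemma is_towerE t :
  is_tower t = [forall i : 'I_n.-1, is_kcycle i.+2 (tower_quotient t i.+2)].
Proof.
apply/forall_inP/forallP => [tow i | cyc k k_gt1].
  have lt_i : i.+2 < n.+1 by rewrite ltnS -ltn_predRL.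
  by have /andP[] := tow (Ordinal lt_i) isT.
have t_cycle j : 2 <= j <= n -> is_kcycle j (tower_quotient t j).
  case: j => [|[|j]] //= lt_jn; rewrite -ltn_predRL in lt_jn.
  exact: cyc (Ordinal lt_jn).
have k_bnd : 2 <= k <= n by rewrite k_gt1 -ltnS ltn_ord.
rewrite t_cycle // andbT -prod_tower_quotient; last exact: ltnW.
exact: prod_kcycles_symGD.
Qed.

Definition quotients (t : n.-1.-tuple 'S_n) : {ffun 'I_n.-1 -> 'S_n} :=
  [ffun i : 'I_n.-1 => tower_quotient t i.+2].

(** The inverse of the map [quotients] sends a sequence to its partial
products. *)
Lemma quotients_bij : bijective quotients.
Proof.
pose v (f : {ffun 'I_n.-1 -> 'S_n}) k := nth 1 (fgraph f) k.-2.
(* Factors are indexed from 2, the coordinates of [f] from 0. *)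
have vE f (i : 'I_n.-1) : v f i.+2 = f i by exact: nth_fgraph_ord.
pose g f k := \big[@perm_comp n/1]_(2 <= i < k.+1) v f i.
have eltE f k : 0 < k <= n ->
  tower_elt [tuple g f (i : 'I_n.-1).+2 | i < n.-1] k = g f k.
  case: k => [|[|k]] //=; first by rewrite /g big_geq.
  rewrite -ltn_predRL => lt_k; rewrite /tower_elt /=.
  by rewrite (nth_map (Ordinal lt_k)) ?size_enum_ord // nth_enum_ord.
exists (fun f => [tuple g f (i : 'I_n.-1).+2 | i < n.-1]) => [t | f].
  apply: eq_from_tnth => i; rewrite tnth_mktuple.
  have -> : tnth t i = tower_elt t i.+2 by rewrite (tnth_nth 1).
  rewrite -prod_tower_quotient //; apply: eq_big_nat => j /andP[].
  case: j => [|[|j]] // _ lt_j.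
  have lt_jn : j < n.-1 by apply: leq_ltn_trans (ltn_ord i); rewrite -2!ltnS.
  by rewrite (vE _ (Ordinal lt_jn)) ffunE.
apply/ffunP => i; rewrite ffunE /tower_quotient.
have lt_i : i.+2 <= n by rewrite -ltn_predRL.
rewrite !eltE //=; last exact: ltnW.
by rewrite {2}/g big_nat_recr //= -/(g f i.+1) /perm_comp mulgK vE.
Qed.

Lemma card_towers :
  #|[set t : n.-1.-tuple 'S_n | is_tower t]| = (\prod_(1 <= i < n) i`!)%N.
Proof.
pose C (i : 'I_n.-1) := [pred u : 'S_n | is_kcycle i.+2 u].
have -> : [set t : n.-1.-tuple 'S_n | is_tower t] = quotients @^-1: family C.
  apply/setP => t; rewrite !inE is_towerE; apply: eq_forallb => i.
  by rewrite ffunE.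
rewrite on_card_preimset; last exact: onW_bij quotients_bij.
rewrite card_family big_add1 big_mkord foldrE big_map enumT.
apply: eq_bigr => i _; rewrite -[i.+1]/(i.+2.-1) -card_kcycles.
  by rewrite cardsE; apply: eq_card.
by rewrite /= -ltn_predRL.
Qed.

End Towers.

Theorem lemma2p5 (n : nat) (hn : (2 <= n)%N) :
  (forall u : nat -> 'S_n,
     (forall k : nat, (2 <= k <= n)%N -> is_kcycle k (u k)) ->
     forall k : nat, (2 <= k <= n)%N ->
       \big[@perm_comp n/1]_(2 <= i < k.+1) u i
         \in symG n k :\: symG n k.-1)
  /\ #|[set t : n.-1.-tuple 'S_n | is_tower t]| = (\prod_(1 <= i < n) i`!)%N.
Proof.
split; last exact: card_towers.
by move=> u u_cycle k; apply: prod_kcycles_symGD.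
Qed.
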